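(* Let $(S,\mathfrak{F},\tau)$ be a probabilistic metric space with $\tau$ continuous, and let $I$ be a non-trivial ideal of $\mathbb{N}\times\mathbb{N}$. Then every double sequence $(x_{jk})_{j,k\in\mathbb{N}}$ in $S$ that is strong $I$-statistically convergent to some point of $S$ is strong $I$-statistically pre-Cauchy.
   Context: Ideals. An ideal on a set $X$ is a class $I\subseteq 2^X$ with $\emptyset\in I$, closed under finite unions and under taking subsets; it is non-trivial if $X\notin I$. Probabilistic metric spaces. $\Delta^+$ is the set of non-decreasing functions $G:[0,\infty]\to[0,1]$ with $G(0)=0$, $G(\infty)=1$, left continuous on $(0,\infty)$ (extended by $G(x)=0$ for $x<0$), ordered pointwise. $\epsilon_0\in\Delta^+$ is given by $\epsilon_0(x)=0$ for $x\le 0$ and $\epsilon_0(x)=1$ for $x>0$. For $F,G\in\Delta^+$, $d_L(F,G)$ is the infimum of all $h\in(0,1]$ such that $F(x-h)-h\le G(x)\le F(x+h)+h$ and $G(x-h)-h\le F(x)\le G(x+h)+h$ for every $x\in(-1/h,1/h)$; $d_L$ is a metric on $\Delta^+$. A triangle function is a binary operation $\tau:\Delta^+\times\Delta^+\to\Delta^+$ that is commutative, associative, non-decreasing in each place, and has $\epsilon_0$ as identity; continuity of $\tau$ is with respect to $d_L$. A probabilistic metric (PM) space is a triple $(S,\mathfrak{F},\tau)$ with $S$ a nonempty set, $\tau$ a triangle function, and $\mathfrak{F}:S\times S\to\Delta^+$, $\mathfrak{F}(x,y)=F_{xy}$, such that for all $x,y,z\in S$: $F_{xx}=\epsilon_0$;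 $F_{xy}\ne\epsilon_0$ if $x\ne y$; $F_{xy}=F_{yx}$; $F_{xz}\ge\tau(F_{xy},F_{yz})$. For $t>0$ put $\mathcal{N}_x(t)=\{y\in S: F_{xy}(t)>1-t\}$ and $\mathfrak{U}(t)=\{(x,y)\in S\times S: F_{xy}(t)>1-t\}$. A double sequence $(x_{jk})$ in $S$ is strong $I$-statistically convergent to $p\in S$ if for all $t>0$ and $\delta>0$, $$\left\{(m,n)\in\mathbb{N}\times\mathbb{N}:\tfrac{1}{mn}\left|\{(j,k): x_{jk}\notin\mathcal{N}_p(t),\ j\le m,\ k\le n\}\right|\ge\delta\right\}\in I.$$ It is strong $I$-statistically pre-Cauchy if for all $t>0$ and $\delta>0$, $$\left\{(m,n)\in\mathbb{N}\times\mathbb{N}:\tfrac{1}{m^2n^2}\left|\{(j,k,p,q): (x_{jk},x_{pq})\notin\mathfrak{U}(t),\ j,p\le m,\ k,q\le n\}\right|\ge\delta\right\}\in I.$$ *)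

(* Defs.v *)
From mathcomp Require Import all_boot all_order all_algebra finmap.
From mathcomp Require Import all_classical all_reals all_analysis.

Set Implicit Arguments.
Unset Strict Implicit.
Unset Printing Implicit Defensive.

Import Order.TTheory GRing.Theory Num.Theory.
Import numFieldNormedType.Exports.

Local Open Scope classical_set_scope.
Local Open Scope ring_scope.

(* In this development N starts at 1, since densities divide by m * n. *)
Definition posnat : Type := {n : nat | (0 < n)%N}.
Definition nat_of_posnat (n : posnat) : nat := val n.
Coercion nat_of_posnat : posnat >-> nat.

Lemma finite_posnat_le (m : nat) : finite_set [set j : posnat | (j <= m)%N].
Proof.
apply: (@finite_preimage _ _ [set j : nat | (j <= m)%N] nat_of_posnat).
  by move=> i j _ _; apply: val_inj.
apply: (sub_finite_set _ (finite_II m.+1)) => j /=; by rewrite ltnS.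
Qed.

Definition is_ideal (X : Type) (I : set (set X)) : Prop :=
  [/\ I set0,
      forall A B, I A -> I B -> I (A `|` B) &
      forall A B, A `<=` B -> I B -> I A].

Definition nontrivial_ideal (X : Type) (I : set (set X)) : Prop :=
  is_ideal I /\ ~ I setT.

(* The class Delta^+.  A function on [0, +oo] is encoded by its extension by 0
   to all of \bar R; [distf_le0] fixes the extension, so Leibniz equality in
   [distf R] is pointwise equality on [0, +oo]. *)
Record distf (R : realType) := Distf {
  distf_fun :> \bar R -> R;
  distf_itv : forall x, 0 <= distf_fun x <= 1;
  distf_nondecreasing :
    forall x y, (x <= y)%E -> distf_fun x <= distf_fun y;
  distf_le0 : forall x, (x <= 0)%E -> distf_fun x = 0;
  distf_pinfty : distf_fun +oo%E = 1;
  distf_left_continuous : forall x : R, 0 < x ->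
    distf_fun y%:E @[y --> x^'-] --> distf_fun x%:E
}.

Definition distf_le (R : realType) (F G : distf R) : Prop :=
  forall x : \bar R, F x <= G x.

Definition eps0_fun (R : realType) (x : \bar R) : R :=
  if (0 < x)%E then 1 else 0.

Lemma eps0_itv (R : realType) (x : \bar R) : 0 <= eps0_fun x <= 1.
Proof. by rewrite /eps0_fun; case: ifP; rewrite ?lexx ?ler01. Qed.

Lemma eps0_nondecreasing (R : realType) (x y : \bar R) :
  (x <= y)%E -> eps0_fun x <= eps0_fun y.
Proof.
move=> xy; rewrite /eps0_fun; case: ifPn => x0.
  by rewrite (lt_le_trans x0 xy).
by case: ifP.
Qed.

Lemma eps0_le0 (R : realType) (x : \bar R) : (x <= 0)%E -> eps0_fun x = 0.
Proof. by move=> x0; rewrite /eps0_fun ltNge x0. Qed.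

Lemma eps0_pinfty (R : realType) : eps0_fun +oo%E = 1 :> R.
Proof. by rewrite /eps0_fun ltry. Qed.

Lemma eps0_left_continuous (R : realType) (x : R) : 0 < x ->
  eps0_fun y%:E @[y --> x^'-] --> eps0_fun x%:E.
Proof.
move=> x0; apply: cvg_near_cst.
apply: filterS (nbhs_left_gt x0) => y y0.
by rewrite /eps0_fun !lte_fin x0 y0.
Qed.

Definition eps0 (R : realType) : distf R :=
  Distf (@eps0_itv R) (@eps0_nondecreasing R) (@eps0_le0 R) (eps0_pinfty R)
    (@eps0_left_continuous R).
Arguments eps0 {R}.

Definition levy_dist (R : realType) (F G : distf R) : R :=
  inf [set h : R | 0 < h <= 1 /\
    forall x : R, - h^-1 < x < h^-1 ->
      [/\ F (x - h)%:E - h <= G x%:E, G x%:E <= F (x + h)%:E + h,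
          G (x - h)%:E - h <= F x%:E & F x%:E <= G (x + h)%:E + h]].

Definition is_triangle_function (R : realType)
    (tau : distf R -> distf R -> distf R) : Prop :=
  [/\ commutative tau,
      associative tau,
      forall F F' G G', distf_le F F' -> distf_le G G' ->
        distf_le (tau F G) (tau F' G') &
      forall F, tau F eps0 = F].

(* Joint continuity, for the metric [levy_dist] on each factor. *)
Definition levy_continuous (R : realType)
    (tau : distf R -> distf R -> distf R) : Prop :=
  forall (F G : distf R) (e : R), 0 < e ->
    exists2 d : R, 0 < d &
      forall F' G' : distf R, levy_dist F F' < d -> levy_dist G G' < d ->
        levy_dist (tau F G) (tau F' G') < e.

Definition is_pm_space (R : realType) (S : Type) (F : S -> S -> distf R)
    (tau : distf R -> distf R -> distf R) : Prop :=
  [/\ inhabited S, is_triangle_function tau &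
   [/\ forall x, F x x = eps0,
       forall x y, x <> y -> F x y <> eps0,
       forall x y, F x y = F y x &
       forall x y z, distf_le (tau (F x y) (F y z)) (F x z)]].

Definition strong_nbhd (R : realType) (S : Type) (F : S -> S -> distf R)
    (x : S) (t : R) : set S :=
  [set y | F x y t%:E > 1 - t].

Definition strong_entourage (R : realType) (S : Type) (F : S -> S -> distf R)
    (t : R) : set (S * S) :=
  [set xy | F xy.1 xy.2 t%:E > 1 - t].

(* The sets counted by [fset_set] below lie in products of the finite sets of
   [finite_posnat_le], so [fset_set] does not fall back to its default value. *)
Definition strong_I_stat_cvg (R : realType) (S : Type)
    (F : S -> S -> distf R) (I : set (set (posnat * posnat)))
    (x : posnat -> posnat -> S) (a : S) : Prop :=
  forall t delta : R, 0 < t -> 0 < delta ->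
    I [set mn : posnat * posnat |
        delta <= ((mn.1 * mn.2)%N%:R)^-1 *
          (#|` fset_set [set jk : posnat * posnat |
             [/\ ~ strong_nbhd F a t (x jk.1 jk.2),
                 (jk.1 <= mn.1)%N & (jk.2 <= mn.2)%N]] |)%:R].

Definition strong_I_stat_pre_cauchy (R : realType) (S : Type)
    (F : S -> S -> distf R) (I : set (set (posnat * posnat)))
    (x : posnat -> posnat -> S) : Prop :=
  forall t delta : R, 0 < t -> 0 < delta ->
    I [set mn : posnat * posnat |
        delta <= ((mn.1 ^ 2 * mn.2 ^ 2)%N%:R)^-1 *
          (#|` fset_set [set jkpq : posnat * posnat * posnat * posnat |
             let: (j, k, p, q) := jkpq in
             [/\ ~ strong_entourage F t (x j k, x p q),
                 (j <= mn.1)%N, (p <= mn.1)%N,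
                 (k <= mn.2)%N & (q <= mn.2)%N]] |)%:R].

(* Main.v *)
Require Import Defs.
From mathcomp Require Import all_boot all_order all_algebra.
From mathcomp Require Import all_classical all_reals all_analysis.
From mathcomp Require Import finmap lra.

(** By continuity of [tau] at [(eps0, eps0)] and the triangle inequality, two
    points of a small enough strong neighbourhood of [a] lie in a given
    entourage.  Hence a bad quadruple [(j, k, p, q)] has a bad half: there are
    at most [2 b m n] of them, where [b] counts the [(j, k)] in the rectangle
    with [x j k] far from [a].  Dividing by [m^2 n^2], the exceptional set for
    [delta] is contained in the one of convergence for [delta / 2]. *)

Import Order.TTheory GRing.Theory Num.Theory.
Local Open Scope classical_set_scope.
Local Open Scope ring_scope.

Section levy_eps0.
Context {R : realType}.
Implicit Types G : distf R.

Lemma distf_ge0 G x : 0 <= G x.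
Proof. by case/andP: (distf_itv G x). Qed.

Lemma distf_le1 G x : G x <= 1.
Proof. by case/andP: (distf_itv G x). Qed.

(** The shift [s] is itself admissible in the infimum. Each inequality splits by which side of its
    jump [eps0] is on: [G] vanishes up to [0] and exceeds [1 - s] from [s] on. *)
Lemma levy_dist_eps0_le G (s : R) :
  0 < s <= 1 -> 1 - s < G s%:E -> levy_dist eps0 G <= s.
Proof.
move=> /andP[s0 s1] Gs; apply: ge_inf.
  by exists 0 => h [/andP[/ltW]].
split; first by rewrite s0.
move=> x _; rewrite /= /eps0_fun !lte_fin.
have G0 := distf_ge0 G; have G1 := distf_le1 G.
have Gle (y : R) : y <= 0 -> G y%:E = 0.
  by move=> y0; apply: distf_le0; rewrite lee_fin.
have Gge (y : R) : s <= y -> 1 - s < G y%:E.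
  by move=> sy; apply: (lt_le_trans Gs); apply: distf_nondecreasing; rewrite lee_fin.
split.
- case: ltP => xs; last by have := G0 x%:E; lra.
  by have := Gge x ltac:(lra); lra.
- case: ltP => xs; first by have := G1 x%:E; lra.
  by rewrite Gle; lra.
- case: ltP => xs; first by have := G1 (x - s)%:E; lra.
  by rewrite Gle; lra.
- case: ltP => xs; last by have := G0 (x + s)%:E; lra.
  by have := Gge (x + s) ltac:(lra); lra.
Qed.

(** Take an admissible [h < t]. The last of its inequalities at [t - h], where [eps0] is [1], reads
    [1 <= G t + h]. The bound [(t + 1)^-1] keeps [t - h] inside the window. *)
Lemma levy_dist_eps0_lt G (t : R) : 0 < t ->
  levy_dist eps0 G < Num.min t (t + 1)^-1 -> 1 - t < G t%:E.
Proof.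
move=> t0; rewrite /levy_dist => /inf_lt; case.
  (* The infimum is over a nonempty set: [1] is always admissible, as all values lie in [[0, 1]]. *)
  exists 1; split=> [|x _]; first by rewrite ltr01 lexx.
  have := distf_ge0 G x%:E; have := distf_le1 G x%:E.
  have := distf_ge0 G (x + 1)%:E; have := distf_le1 G (x - 1)%:E.
  rewrite /= /eps0_fun.
  by split; repeat case: ifP => _; lra.
move=> h [/andP[h0 h1] hG]; rewrite lt_min => /andP[ht].
have t10 : 0 < t + 1 by lra.
(* Now [t + 1 < h^-1], so [t - h < h^-1]. *)
rewrite -[h]invrK ltf_pV2 ?posrE ?invr_gt0// => th.
have [_ _ _] := hG (t - h) ltac:(lra).
by rewrite subrK /= /eps0_fun lte_fin subr_gt0 ht; lra.
Qed.

End levy_eps0.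

Lemma strong_nbhd_entourage (R : realType) (S : Type) (F : S -> S -> distf R)
    (tau : distf R -> distf R -> distf R) (a : S) (t : R) :
  is_pm_space F tau -> levy_continuous tau -> 0 < t ->
  exists2 s : R, 0 < s & forall y z,
    strong_nbhd F a s y -> strong_nbhd F a s z -> strong_entourage F t (y, z).
Proof.
move=> [_ [_ _ _ tau1] [_ _ Fsym Ftri]] tauC t0.
have e0 : 0 < Num.min t (t + 1)^-1.
  by rewrite lt_min t0 invr_gt0; lra.
have [d d0 taud] := tauC eps0 eps0 _ e0.
(* [levy_dist_eps0_le] requires a radius at most [1] and bounds the distance only weakly, hence the
   cap and the half. *)
exists (Num.min 1 (d / 2)) => [|y z ay az].
  by rewrite lt_min ltr01 divr_gt0.
have near_eps0 u : strong_nbhd F a (Num.min 1 (d / 2)) u ->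
    levy_dist eps0 (F a u) < d.
  move=> au; apply: (@le_lt_trans _ _ (Num.min 1 (d / 2))).
    by apply: levy_dist_eps0_le => //; rewrite lt_min ltr01 divr_gt0//= ge_min lexx.
  by rewrite gt_min; apply/orP; right; lra.
have := taud _ _ (near_eps0 y ay) (near_eps0 z az).
rewrite tau1 => /(levy_dist_eps0_lt _ _ t0) /lt_le_trans; apply.
by rewrite (Fsym a y); apply: Ftri.
Qed.

Lemma card_fset_set_le_size (T : choiceType) (U : eqType) (A : set T)
    (f : T -> U) (s : seq U) :
  injective f -> (forall x, A x -> f x \in s) ->
  (#|` fset_set A | <= size s)%N.
Proof.
move=> f_inj As; have [Afin|Ainf] := pselect (finite_set A); last first.
  (* On an infinite set [fset_set] defaults to the empty set, of cardinal [0]. *)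
  by rewrite /fset_set; case: pselect.
rewrite -(size_map f); apply: uniq_leq_size.
  by rewrite map_inj_uniq// fset_uniq.
move=> _ /mapP[x xA ->]; apply: As.
by move: xA; rewrite in_fset_set// => /set_mem.
Qed.

Definition posnat_rect (m n : nat) : set (posnat * posnat) :=
  [set jk : posnat * posnat | (jk.1 <= m)%N /\ (jk.2 <= n)%N].

Lemma finite_posnat_rect m n : finite_set (posnat_rect m n).
Proof. exact: finite_setX (finite_posnat_le m) (finite_posnat_le n). Qed.

Lemma card_posnat_rect m n : (#|` fset_set (posnat_rect m n) | <= m * n)%N.
Proof.
(* Indices start at [1], so the rectangle has [m * n] points, not [m.+1 * n.+1]. *)
have <- : size [seq (j, k) | j <- iota 1 m, k <- iota 1 n] = (m * n)%N.
  by rewrite size_allpairs !size_iota.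
apply: (card_fset_set_le_size _ _ _
    (fun jk : posnat * posnat => (val jk.1, val jk.2))).
  by move=> [j k] [j' k'] [/val_inj -> /val_inj ->].
move=> [[j j0] [k k0]] [/= jm kn].
by apply/allpairsP; exists (j, k); rewrite !mem_iota j0 k0 !add1n !ltnS.
Qed.

Lemma card_pairs_le (m n : nat) (B : set (posnat * posnat))
    (Q : set (posnat * posnat * posnat * posnat)) :
  B `<=` posnat_rect m n ->
  (forall j k p q, Q (j, k, p, q) ->
    [/\ posnat_rect m n (j, k), posnat_rect m n (p, q) &
        B (j, k) \/ B (p, q)]) ->
  (#|` fset_set Q | <= 2 * #|` fset_set B | * (m * n))%N.
Proof.
move=> Brect QB.
have Bfin : finite_set B := sub_finite_set Brect (finite_posnat_rect m n).
have Rfin := finite_posnat_rect m n.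
pose b := fset_set B : seq _; pose r := fset_set (posnat_rect m n) : seq _.
have mem_b u : B u -> u \in b by move=> Bu; rewrite /b in_fset_set//; exact: mem_set.
have mem_r u : posnat_rect m n u -> u \in r.
  by move=> ru; rewrite /r in_fset_set//; exact: mem_set.
(* Regrouped as pairs of pairs, the quadruples are covered by [b] times [r] and [r] times [b], two
   lists of equal size. *)
apply: (@leq_trans (size ([seq (u, v) | u <- b, v <- r] ++
                          [seq (u, v) | u <- r, v <- b]))).
  apply: (card_fset_set_le_size _ _ _
    (fun w : posnat * posnat * posnat * posnat =>
      ((w.1.1.1, w.1.1.2), (w.1.2, w.2)))).
    by move=> [[[j k] p] q] [[[j' k'] p'] q'] [-> -> -> ->].
  move=> [[[j k] p] q] /QB[jk pq [Bjk|Bpq]]; rewrite mem_cat; apply/orP.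
    by left; apply: allpairs_f; [exact: mem_b|exact: mem_r].
  by right; apply: allpairs_f; [exact: mem_r|exact: mem_b].
rewrite size_cat !size_allpairs [(size r * _)%N]mulnC addnn -mul2n -mulnA.
by rewrite !leq_mul2l card_posnat_rect !orbT.
Qed.

Theorem theorem3p1 (R : realType) (S : Type) (F : S -> S -> distf R)
    (tau : distf R -> distf R -> distf R)
    (I : set (set (posnat * posnat))) :
  is_pm_space F tau -> levy_continuous tau -> nontrivial_ideal I ->
  forall x : posnat -> posnat -> S,
    (exists a : S, strong_I_stat_cvg F I x a) ->
    strong_I_stat_pre_cauchy F I x.
Proof.
move=> Fpm tauC [[_ _ Isub] _] x [a xa] t delta t0 delta0.
have [s s0 sU] := strong_nbhd_entourage _ _ _ _ a _ Fpm tauC t0.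
have delta20 : 0 < delta / 2 by rewrite divr_gt0.
apply: Isub (xa s _ s0 delta20) => -[m n] /=.
set Q := [set _ | _]; set B := [set _ | _] => deltaQ.
have QB : (#|` fset_set Q | <= 2 * #|` fset_set B | * (m * n))%N.
  apply: card_pairs_le => [jk [_ //]|j k p q [Ujkpq jm pm kn qn]].
  split=> //; have [ajk|najk] := pselect (strong_nbhd F a s (x j k)).
    right; split=> // apq; apply: Ujkpq; exact: sU.
  by left.
have mn0 : 0 < (m * n)%:R :> R.
  by rewrite ltr0n muln_gt0 (valP m) (valP n).
move: QB; rewrite -(ler_nat R) => QB.
(* Clearing the denominator [(m * n) ^ 2] and cancelling one factor [m * n] against the bound [QB]
   leaves [delta * (m * n)] at most twice the cardinal of [B]. *)
move: deltaQ; rewrite -expnMn natrX mulrC ler_pdivlMr ?exprn_gt0//.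
move=> /le_trans /(_ QB).
rewrite expr2 mulrA [leRHS]natrM ler_pM2r// [leRHS]natrM => deltaB.
by rewrite [leRHS]mulrC ler_pdivlMr//; lra.
Qed.
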